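(* Let $b,\Delta\in R=\mathbb{F}_{2^n}[T]$ with $b\neq 0$ and $\Delta\notin\varphi(R)$, where $\varphi(t)=t^2+bt$. Direct composition induces an operation on $C(b,\Delta)$. More precisely: for all $[(a_1,b,c_1)],[(a_2,b,c_2)]\in C(b,\Delta)$ there exists exactly one class $[(a_3,b,c_3)]\in C(b,\Delta)$ such that $(a_3,b,c_3)$ is a direct composition of $(a_1,b,c_1)$ and $(a_2,b,c_2)$, and $[(a_3,b,c_3)]$ does not depend on the choice of representatives of $[(a_1,b,c_1)]$ and $[(a_2,b,c_2)]$. Write $[(a_1,b,c_1)][(a_2,b,c_2)]=[(a_3,b,c_3)]$. Furthermore, for all $[(a,b,c)],[(A,b,C)]\in C(b,\Delta)$, $$[(a,b,c)][(A,b,C)]=[(A,b,C)][(a,b,c)],$$ $$[(1,b,\Delta)][(a,b,c)]=[(a,b,c)],$$ $$[(a,b,c)][(c,b,a)]=[(1,b,ac)]=[(1,b,\Delta)].$$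
   Context: $R=\mathbb{F}_{2^n}[T]$. The triple $(a,b,c)\in R^3$ denotes the binary quadratic form $ax^2+bxy+cy^2$; it is primitive if $a,b,c$ have no common non-unit divisor. Fix a subgroup $G$ of $(\mathbb{F}_{2^n},+)$ with $\#G=2^{n-1}$ and $1\notin G$, and set $R_b=\{qb+r : q,r\in R,\ \deg r<\deg b,\ q(0)\in G\}$ (with $\deg 0=-\infty$). $R_b$ is a subgroup of $(R,+)$, and for every $k\in R$ exactly one of $k,k+b$ lies in $R_b$. For $\gamma=\begin{pmatrix} p & q \\ r & s \end{pmatrix}\in Sl_2(R)$ put $\gamma(a,b,c)=(ap^2+bpq+cq^2,\ b,\ ar^2+brs+cs^2)$. Primitive forms $(a,b,c)$ and $(A,b,C)$ are properly equivalent, $(a,b,c)\approx(A,b,C)$, if there is such a $\gamma$ with $\gamma(a,b,c)=(A,b,C)$ and $apr+bqr+cqs\in R_b$. This is an equivalence relation; $[(a,b,c)]$ denotes the class. $C(b,\Delta)=\{[(a,b,c)] : (a,b,c)\text{ primitive},\ a,c\in R,\ ac\equiv\Delta \bmod \varphi(R)\}$. A form $(a_3,b,c_3)$ is a direct composition of $(a_1,b,c_1)$ and $(a_2,b,c_2)$ if there exist $p_i,q_i,r_i,s_i\in R$ ($i=1,2$) such that, as polynomials in $x,y,z,w$, $$(a_1x^2+bxy+c_1y^2)(a_2z^2+bzw+c_2w^2)=a_3L_1^2+bL_1L_2+c_3L_2^2,\quad L_i=p_ixz+q_ixw+r_iyz+s_iyw,$$ and $q_1r_2+q_2r_1\in R_b$,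 $p_2s_1+q_2r_1\in R_b$. *)

(* Defs.v *)
From HB Require Import structures.
From mathcomp Require Import all_boot all_order all_algebra.
From mathcomp Require Import classical_sets.
From mathcomp Require Import mpoly.

Set Implicit Arguments.
Unset Strict Implicit.
Unset Printing Implicit Defensive.

Import GRing.Theory.

Local Open Scope ring_scope.
Local Open Scope classical_set_scope.

(* Throughout, F is a finite field of characteristic 2, so that signs do not
   matter, and the ring R is {poly F}. *)

Record qform (F : finFieldType) :=
  QForm { qa : {poly F}; qb : {poly F}; qc : {poly F} }.

Definition primitive (F : finFieldType) (f : qform F) : Prop :=
  forall d : {poly F}, d %| qa f -> d %| qb f -> d %| qc f ->
    d \is a GRing.unit.

Definition phi (F : finFieldType) (b t : {poly F}) : {poly F} :=
  t ^+ 2 + b * t.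

(* size p = deg p + 1 and size 0 = 0, so that size r < size b also renders
   deg r < deg b with the convention deg 0 = -oo. *)
Definition Rset (F : finFieldType) (G : {set F}) (b : {poly F}) :
    set {poly F} :=
  [set k | exists q r : {poly F},
    [/\ k = q * b + r, (size r < size b)%N & q.[0] \in G]].

Definition qform_act (F : finFieldType) (g : 'M[{poly F}]_2) (f : qform F) :
    qform F :=
  let: (p, q, r, s) := (g 0 0, g 0 1, g 1 0, g 1 1) in
  let: QForm a b c := f in
  QForm (a * p ^+ 2 + b * p * q + c * q ^+ 2) b
        (a * r ^+ 2 + b * r * s + c * s ^+ 2).

Definition properly_equivalent (F : finFieldType) (G : {set F})
    (f f' : qform F) : Prop :=
  [/\ primitive f, primitive f' &
    exists g : 'M[{poly F}]_2,
      let: (p, q, r, s) := (g 0 0, g 0 1, g 1 0, g 1 1) in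
      let: QForm a b c := f in
      [/\ \det g = 1, qform_act g f = f' &
          Rset G b (a * p * r + b * q * r + c * q * s)]].

Definition qclass (F : finFieldType) (G : {set F}) (f : qform F) :
    set (qform F) :=
  [set f' | properly_equivalent G f f'].

Definition classes (F : finFieldType) (G : {set F}) (b Delta : {poly F}) :
    set (set (qform F)) :=
  [set X | exists a c : {poly F},
    [/\ primitive (QForm a b c),
        exists t : {poly F}, a * c - Delta = phi b t &
        X = qclass G (QForm a b c)]].

Definition qform_eval (F : finFieldType) (f : qform F)
    (u v : {mpoly {poly F}[4]}) : {mpoly {poly F}[4]} :=
  qa f *: u ^+ 2 + qb f *: (u * v) + qc f *: v ^+ 2.

(* The four indeterminates x, y, z, w are 'X_0, 'X_1, 'X_2, 'X_3. *)
Definition bilin4 (F : finFieldType) (p q r s : {poly F}) :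
    {mpoly {poly F}[4]} :=
  let: (x, y, z, w) := ('X_(0 : 'I_4), 'X_(1 : 'I_4),
                        'X_(2 : 'I_4), 'X_(3 : 'I_4)) in
  p *: (x * z) + q *: (x * w) + r *: (y * z) + s *: (y * w).

Definition direct_composition (F : finFieldType) (G : {set F})
    (f1 f2 f3 : qform F) : Prop :=
  let: (x, y, z, w) := ('X_(0 : 'I_4), 'X_(1 : 'I_4),
                        'X_(2 : 'I_4), 'X_(3 : 'I_4)) in
  let b := qb f1 in
  [/\ qb f2 = b, qb f3 = b &
    exists p1 q1 r1 s1 p2 q2 r2 s2 : {poly F},
      [/\ qform_eval f1 x y * qform_eval f2 z w
            = qform_eval f3 (bilin4 p1 q1 r1 s1) (bilin4 p2 q2 r2 s2),
          Rset G b (q1 * r2 + q2 * r1) &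
          Rset G b (p2 * s1 + q2 * r1)]].

(* Main.v *)
Require Import Defs.
From HB Require Import structures.
From mathcomp Require Import all_boot all_order all_algebra.
From mathcomp Require Import finfield.
From mathcomp Require Import classical_sets.
From mathcomp Require Import mpoly.
From mathcomp Require Import ring.
Import GRing.Theory.
Local Open Scope ring_scope.
Local Open Scope classical_set_scope.

Set Implicit Arguments.
Unset Strict Implicit.
Unset Printing Implicit Defensive.

(** In characteristic 2 a change of basis of determinant 1 may reverse the
    orientation of a binary form, and the half-system R_b is what restores the
    orientation: a form with a c = Delta + phi(t) has two such t, which differ
    by b, and R_b contains exactly one of them.

    The proof reads direct composition through the 2 x 4 matrix M of the
    coefficients of L_1 and L_2, with columns indexed by xz, xw, yz, yw (a
    Bhargava cube). Write P_ij for its minors. The equation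
    f_1 f_2 = f_3(L_1, L_2) holds if and only if P_12 = a_1, P_34 = c_1,
    P_13 = a_2, P_24 = c_2, P_14 + P_23 = b, a_3 = p_2 s_2 + q_2 r_2 and
    c_3 = p_1 s_1 + q_1 r_1, provided that a_1 and b are nonzero
    ([cube_direct_composition] and [direct_composition_cube]); a_1 is nonzero
    because Delta is not a value of phi. The Pluecker relation becomes
    phi(P_23) = a_1 c_1 + a_2 c_2, and u = p_2 s_1 + q_2 r_1 satisfies
    a_3 c_3 = a_1 c_1 + phi(u); the two conditions that involve R_b select
    P_23 and u among the two solutions of these equations.

    Uniqueness up to proper equivalence ([cube_composition_unique]): f_1 and
    f_2 determine all minors of M, also P_23 because of R_b. The minors
    generate the unit ideal since f_1 is primitive, so two matrices M, M' for
    the same f_1 and f_2 differ by an element of SL_2 ([eq_minors_SL2]). It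
    transports f_3 to f_3', and changes u by the element that must lie in R_b
    for a proper equivalence.

    Existence ([cube_composition_exists]): a 2 x 4 matrix with prescribed
    minors subject to the Pluecker relation is written down from a Bezout
    relation for a_1, a_2 and P_14; exchanging its rows replaces u by u + b.

    Independence of representatives ([cube_composition_pequiv]): a proper
    equivalence of f_1 acts on the matrix by combining its columns and adds the
    same element of R_b to P_23 and to u. Transposing the columns 2 and 3
    exchanges f_1 and f_2 ([cube_composition_sym]), which gives the same for
    f_2 and the commutativity. Explicit matrices yield the neutral element and
    the inverses. *)

(** * Identities in characteristic 2 *)

(** The even coefficients that occur in the identities below. *)
Lemma even_natr_char2 (R : comNzRingType) : 2 = 0 :> R ->
  [/\ - 2 = 0 :> R, 4 = 0 :> R, - 4 = 0 :> R, 6 = 0 :> R & - 6 = 0 :> R].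
Proof.
move=> two0; have two k : (k * 2)%N%:R = 0 :> R by rewrite natrM two0 mulr0.
have [] := (two 2, two 3); rewrite /= => h4 h6.
by split; rewrite ?two0 ?h4 ?h6 ?oppr0.
Qed.

(** Ring normalization over the integers, in which the even coefficients are
    then rewritten to 0. Both sides are first moved to the left, because equal
    monomials of opposite sign only disappear when they meet in one normal
    form. *)
Tactic Notation "char2_ring" constr(two0) :=
  apply: GRing.subr0_eq;
  let m2 := fresh in let p4 := fresh in let m4 := fresh in
  let p6 := fresh in let m6 := fresh in
  have [m2 p4 m4 p6 m6] := even_natr_char2 two0;
  let p2 := fresh in have p2 := two0;
  ring: p2 m2 p4 m4 p6 m6.

(** The same modulo equations such as p s = 1 + q r, which expresses that a
    matrix has determinant 1. *)
Tactic Notation "char2_ring" constr(two0) "with" constr(h) :=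
  apply: GRing.subr0_eq;
  let m2 := fresh in let p4 := fresh in let m4 := fresh in
  let p6 := fresh in let m6 := fresh in
  have [m2 p4 m4 p6 m6] := even_natr_char2 two0;
  let p2 := fresh in have p2 := two0;
  ring: p2 m2 p4 m4 p6 m6 h.

Tactic Notation "char2_ring" constr(two0) "with" constr(h) "," constr(h1) :=
  apply: GRing.subr0_eq;
  let m2 := fresh in let p4 := fresh in let m4 := fresh in
  let p6 := fresh in let m6 := fresh in
  have [m2 p4 m4 p6 m6] := even_natr_char2 two0;
  let p2 := fresh in have p2 := two0;
  ring: p2 m2 p4 m4 p6 m6 h h1.

(** * The half-system R_b *)

Section HalfSystem.

Variables (F : finFieldType) (G : {set F}) (b : {poly F}).
Hypotheses (two0 : 2 = 0 :> {poly F}) (b_neq0 : b != 0).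
Hypotheses (subG : zmod_closed (mem G)) (G1 : 1 \notin G).
Hypothesis cardG : (#|G| * 2)%N = #|F|.

(** The pair (q, r) in the definition is the Euclidean division by [b]. *)
Lemma RsetE k : Rset G b k <-> (k %/ b).[0] \in G.
Proof.
split=> [[q [r [-> r_lt q0G]]] | kG].
  by rewrite divpD mulpK // divp_small // addr0.
by exists (k %/ b), (k %% b); rewrite -divp_eq ltn_modp.
Qed.

Lemma Rset0 : Rset G b 0.
Proof. by apply/RsetE; rewrite div0p horner0; case: subG. Qed.

Lemma RsetD k l : Rset G b k -> Rset G b l -> Rset G b (k + l).
Proof.
move=> /RsetE kG /RsetE lG; apply/RsetE; rewrite divpD hornerD.
have [_ subGB] := subG.
have G0 : 0 \in G by case: subG.
have -> : (k %/ b).[0] + (l %/ b).[0] = (k %/ b).[0] - (0 - (l %/ b).[0]).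
  by rewrite sub0r opprK.
by apply: (subGB) => //; apply: (subGB).
Qed.

Lemma Rset_middle : ~ Rset G b b.
Proof. by move/RsetE; rewrite divpp // hornerC; apply/negP. Qed.

(** [G] has index 2, so [G] and [1 + G] cover the field. *)
Lemma Rset_or k : Rset G b k \/ Rset G b (k + b).
Proof.
suff: ((k %/ b).[0] \in G) || ((k %/ b).[0] + 1 \in G).
  case/orP=> kG; [left | right]; apply/RsetE => //.
  by rewrite divpD divpp // hornerD hornerC.
set u := (k %/ b).[0].
have tr_inj : injective (fun g : F => g - 1) by apply: addIr.
have [_ subGB] := subG.
have disj : G :&: [set g - 1 | g in G]%SET = finset.set0.
  apply/eqP; rewrite -finset.subset0; apply/fintype.subsetP=> g.
  rewrite inE => /andP[gG].
  case/imsetP=> h hG gE; case/negP: G1.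
  have -> : 1 = h - g by rewrite gE opprB addrC subrK.
  exact: subGB.
have cov : #|G :|: [set g - 1 | g in G]%SET| = #|F|.
  by rewrite cardsU disj cards0 subn0 card_imset // -cardG muln2 addnn.
have : u \in G :|: [set g - 1 | g in G]%SET.
  have /eqP -> : G :|: [set g - 1 | g in G]%SET == finset.setT.
    by rewrite eqEcard finset.subsetT cov cardsT leqnn.
  by rewrite inE.
rewrite inE => /orP[-> // | /imsetP[g gG ->]].
by rewrite subrK gG orbT.
Qed.

(** The two roots of a quadratic [phi b X = e] differ by [b], and only one of
    them lies in [R_b]. *)
Lemma Rset_phi_inj u v :
  Rset G b u -> Rset G b v -> phi b u = phi b v -> u = v.
Proof.
move=> uR vR eq_phi; have : (u + v) * (u + v + b) = 0.
  have -> : (u + v) * (u + v + b) = phi b u + phi b v.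
    by rewrite /phi; char2_ring two0.
  by rewrite eq_phi /phi; char2_ring two0.
move/eqP; rewrite mulf_eq0 => /orP[]/eqP uv0.
  by rewrite -[u]addr0 -uv0; char2_ring two0.
have uvE : u + v = b by rewrite -[b]add0r -uv0; char2_ring two0.
by case: Rset_middle; rewrite -[X in Rset _ _ X]uvE; apply: RsetD.
Qed.

End HalfSystem.

(** * Equal minors and Bezout relations *)

(** Write P i j for the common minor on the columns i and j. Cramer's rule gives
    N_ij adj(M_ij) M_k = P i j N_k, first with the minors of M and then with
    those of N. A single minor need not be invertible, but if the sum of the
    l i j P i j is 1, then the sum of the matrices N_ij adj(M_ij) with the
    weights l i j carries M to N. *)
Lemma eq_minors_SL2 (R : comNzRingType) (I : finType) (m n : bool -> I -> R)
    (l : I -> I -> R) :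
  (forall i j, m false i * m true j - m true i * m false j
             = n false i * n true j - n true i * n false j) ->
  \sum_i \sum_j l i j * (m false i * m true j - m true i * m false j) = 1 ->
  exists g : bool -> bool -> R,
    (forall x i, n x i = g x false * m false i + g x true * m true i) /\
    g false false * g true true - g false true * g true false = 1.
Proof.
move=> eq_mn lm1.
pose g x y := \sum_i \sum_j l i j *
  (if y then n x j * m false i - n x i * m false j
        else n x i * m true j - n x j * m true i).
have gE x k : n x k = g x false * m false k + g x true * m true k.
  rewrite -[LHS]mulr1 -lm1 !mulr_suml !mulr_sumr -big_split /=.
  apply: eq_bigr => i _; rewrite !mulr_suml !mulr_sumr -big_split /=.
  apply: eq_bigr => j _.
  transitivity (l i j * (n x i * (m false k * m true j - m true k * m false j)
    + n x j * (m false i * m true k - m true i * m false k))); last by ring.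
  by rewrite !eq_mn; case: x; ring.
exists g; split=> //.
rewrite -[LHS]mulr1 -[in LHS]lm1 -[RHS]lm1 mulr_sumr; apply: eq_bigr => i _.
rewrite mulr_sumr; apply: eq_bigr => j _.
by rewrite [in RHS]eq_mn !gE; ring.
Qed.

Lemma bezout3 (F : fieldType) (a b c : {poly F}) :
  exists e x y z,
    [/\ e = x * a + y * b + z * c, e %| a, e %| b & e %| c].
Proof.
have [[u v] /= uvE] := Bezoutp a b.
have [[w z] /= wzE] := Bezoutp (u * a + v * b) c.
set e := w * (u * a + v * b) + z * c in wzE.
have : e %| gcdp (u * a + v * b) c by rewrite (eqp_dvdl _ wzE).
rewrite dvdp_gcd (eqp_dvdr _ uvE) dvdp_gcd => /andP[/andP[ea eb] ec].
by exists e, (w * u), (w * v), z; split=> //; rewrite /e; ring.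
Qed.

Lemma primitiveP (F : finFieldType) (f : qform F) :
  primitive f <-> exists x y z, x * qa f + y * qb f + z * qc f = 1.
Proof.
split=> [prim_f | [x [y [z xyz1]]] d da db dc].
  have [e [x [y [z [eE ea eb ec]]]]] := bezout3 (qa f) (qb f) (qc f).
  have e_unit := prim_f e ea eb ec.
  exists (e^-1 * x), (e^-1 * y), (e^-1 * z).
  by rewrite -!mulrA -!mulrDr -eE mulVr.
have : d %| x * qa f + y * qb f + z * qc f by rewrite !dvdp_add // dvdp_mull.
rewrite xyz1 => /dvdpP[k kE]; have := unitr1 {poly F}.
by rewrite kE unitrM => /andP[].
Qed.

Lemma det_mx22 (R : comNzRingType) (g : 'M[R]_2) :
  \det g = g 0 0 * g 1 1 - g 0 1 * g 1 0.
Proof.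
have e0 : lift (0 : 'I_2) (0 : 'I_1) = 1 by apply/ord_inj.
have e1 : lift (1 : 'I_2) (0 : 'I_1) = 0 by apply/ord_inj.
rewrite (expand_det_row _ 0) !big_ord_recl big_ord0 addr0.
rewrite /cofactor !det_mx11 !mxE.
by rewrite e0 e1 expr0 expr1 mul1r mulN1r mulrN.
Qed.

(** * Properly equivalent forms *)

Section Equivalence.

Variables (F : finFieldType) (G : {set F}).
Hypothesis two0 : 2 = 0 :> {poly F}.

Lemma properly_equivalentP (a b c : {poly F}) (f : qform F) :
  properly_equivalent G (QForm a b c) f <->
  [/\ primitive (QForm a b c), primitive f &
    exists p q r s : {poly F}, [/\ p * s = 1 + q * r,
      f = QForm (a * p ^+ 2 + b * p * q + c * q ^+ 2) b
                (a * r ^+ 2 + b * r * s + c * s ^+ 2) &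
      Rset G b (a * p * r + b * q * r + c * q * s)]].
Proof.
split=> [[prim prim' [g]] /= [detg fE gR]
  | [prim prim' [p [q [r [s [det1 fE gR]]]]]]].
  split=> //; exists (g 0 0), (g 0 1), (g 1 0), (g 1 1).
  by split=> //; rewrite -detg det_mx22; ring.
split=> //; exists (\matrix_(i < 2, j < 2)
  if i == 0 then (if j == 0 then p else q) else (if j == 0 then r else s)).
by rewrite /qform_act det_mx22 !mxE /= det1 -fE; split=> //; ring.
Qed.

(** A change of basis shifts the t with a c = Delta + phi(t) by the element
    a p r + b q r + c q s; this is why its membership in R_b measures whether
    the orientation is preserved. *)
Lemma act_middle_phi (a b c p q r s : {poly F}) : p * s = 1 + q * r ->
  (a * p ^+ 2 + b * p * q + c * q ^+ 2) * (a * r ^+ 2 + b * r * s + c * s ^+ 2)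
  = a * c + phi b (a * p * r + b * q * r + c * q * s).
Proof. by move=> det1; rewrite /phi; char2_ring two0 with det1. Qed.

Lemma pequiv_phi f f' : properly_equivalent G f f' ->
  qb f' = qb f /\ exists t, qa f' * qc f' = qa f * qc f + phi (qb f) t.
Proof.
case: f => a b c /properly_equivalentP[_ _ [p [q [r [s [det1 -> _]]]]]].
split=> //=; exists (a * p * r + b * q * r + c * q * s).
exact: act_middle_phi.
Qed.

Lemma pequiv_refl f : zmod_closed (mem G) -> qb f != 0 ->
  primitive f -> properly_equivalent G f f.
Proof.
case: f => a b c /= subG b_neq0 prim; apply/properly_equivalentP; split=> //.
exists 1, 0, 0, 1; split; first by ring.
  by congr QForm; ring.
by rewrite !mulr0 !mul0r !addr0; apply: Rset0.
Qed.

Lemma pequiv_sym f f' :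
  properly_equivalent G f f' -> properly_equivalent G f' f.
Proof.
case: f => a b c.
case/properly_equivalentP=> prim prim' [p [q [r [s [det1 f'E gR]]]]].
rewrite {}f'E in prim' *; apply/properly_equivalentP; split=> //.
exists s, q, r, p; split; first by rewrite mulrC det1.
  by congr QForm; char2_ring two0 with det1.
set v := (X in Rset _ _ X) in gR; set v' := (X in Rset _ _ X).
suff -> : v' = v by [].
by rewrite /v /v'; char2_ring two0 with det1.
Qed.

Lemma pequiv_trans f1 f2 f3 : zmod_closed (mem G) -> qb f1 != 0 ->
  properly_equivalent G f1 f2 -> properly_equivalent G f2 f3 ->
  properly_equivalent G f1 f3.
Proof.
case: f1 => a b c subG b_neq0.
case/properly_equivalentP=> prim1 prim2 [p [q [r [s [det1 f2E gR]]]]].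
rewrite {}f2E in prim2 *.
case/properly_equivalentP=> _ prim3 [p' [q' [r' [s' [det1' f3E gR']]]]].
rewrite {}f3E in prim3 *; apply/properly_equivalentP; split=> //.
exists (p' * p + q' * r), (p' * q + q' * s).
exists (r' * p + s' * r), (r' * q + s' * s).
split.
- have -> : (p' * p + q' * r) * (r' * q + s' * s)
    = (p' * s' + q' * r') * (p * s + q * r)
      + (p' * q + q' * s) * (r' * p + s' * r).
    by char2_ring two0.
  by rewrite det1 det1'; char2_ring two0.
- by congr QForm; char2_ring two0 with det1.
have := RsetD b_neq0 subG gR gR'.
set v := (X in Rset _ _ X); set v' := (X in _ -> Rset _ _ X).
suff -> : v = v' by [].
by rewrite /v /v'; char2_ring two0 with det1, det1'.
Qed.

End Equivalence.

(** * Cubes and direct composition *)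

(** The identity behind composition: the three forms are the determinants of
    the three pencils of 2 x 2 slices of a 2 x 2 x 2 cube, the third with its
    variables exchanged. *)
Lemma cube_identity (R : comNzRingType) (two0 : 2 = 0 :> R)
    (p1 q1 r1 s1 p2 q2 r2 s2 b x y z w : R) :
  b = p1 * s2 + p2 * s1 + q1 * r2 + q2 * r1 ->
  let L1 := p1 * (x * z) + q1 * (x * w) + r1 * (y * z) + s1 * (y * w) in
  let L2 := p2 * (x * z) + q2 * (x * w) + r2 * (y * z) + s2 * (y * w) in
  ((p1 * q2 + p2 * q1) * x ^+ 2 + b * (x * y) + (r1 * s2 + r2 * s1) * y ^+ 2) *
  ((p1 * r2 + p2 * r1) * z ^+ 2 + b * (z * w) + (q1 * s2 + q2 * s1) * w ^+ 2)
  = (p2 * s2 + q2 * r2) * L1 ^+ 2 + b * (L1 * L2)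
    + (p1 * s1 + q1 * r1) * L2 ^+ 2.
Proof. by move=> -> L1 L2; rewrite /L1 /L2; char2_ring two0. Qed.

Section Cubes.

Variables (F : finFieldType) (G : {set F}) (b : {poly F}).
Hypotheses (two0 : 2 = 0 :> {poly F}) (b_neq0 : b != 0).
Hypothesis subG : zmod_closed (mem G).

(** The rows (p1, q1, r1, s1) and (p2, q2, r2, s2) are the coefficients of L_1
    and L_2; the coefficients of [f1] and [f2] are minors of this 2 x 4 matrix,
    and those of [f3] are the determinants of its rows, read as 2 x 2
    matrices. *)
Definition cube_composition (f1 f2 f3 : qform F) : Prop :=
  exists p1 q1 r1 s1 p2 q2 r2 s2 : {poly F},
    [/\ b = p1 * s2 + p2 * s1 + q1 * r2 + q2 * r1,
        f1 = QForm (p1 * q2 + p2 * q1) b (r1 * s2 + r2 * s1),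
        f2 = QForm (p1 * r2 + p2 * r1) b (q1 * s2 + q2 * s1),
        f3 = QForm (p2 * s2 + q2 * r2) b (p1 * s1 + q1 * r1) &
        Rset G b (q1 * r2 + q2 * r1) /\ Rset G b (p2 * s1 + q2 * r1)].

Lemma cube_direct_composition f1 f2 f3 :
  cube_composition f1 f2 f3 -> direct_composition G f1 f2 f3.
Proof.
case=> p1 [q1 [r1 [s1 [p2 [q2 [r2 [s2 [bE -> -> -> [tR uR]]]]]]]]].
split=> //; exists p1, q1, r1, s1, p2, q2, r2, s2; split=> //.
have two0M : 2 = 0 :> {mpoly {poly F}[4]}.
  by rewrite -[2](rmorph_nat (@mpolyC 4 {poly F})) two0 rmorph0.
rewrite /qform_eval /bilin4 /= -!mul_mpolyC !(mpolyCD, mpolyCM).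
apply: (cube_identity two0M).
by rewrite bE !(mpolyCD, mpolyCM).
Qed.

Lemma direct_composition_eval f1 f2 f3 p1 q1 r1 s1 p2 q2 r2 s2 :
  qform_eval f1 'X_(0 : 'I_4) 'X_(1 : 'I_4)
      * qform_eval f2 'X_(2 : 'I_4) 'X_(3 : 'I_4)
    = qform_eval f3 (bilin4 p1 q1 r1 s1) (bilin4 p2 q2 r2 s2) ->
  forall x y z w : {poly F},
  let L1 := p1 * (x * z) + q1 * (x * w) + r1 * (y * z) + s1 * (y * w) in
  let L2 := p2 * (x * z) + q2 * (x * w) + r2 * (y * z) + s2 * (y * w) in
  (qa f1 * x ^+ 2 + qb f1 * (x * y) + qc f1 * y ^+ 2) *
  (qa f2 * z ^+ 2 + qb f2 * (z * w) + qc f2 * w ^+ 2)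
  = qa f3 * L1 ^+ 2 + qb f3 * (L1 * L2) + qc f3 * L2 ^+ 2.
Proof.
move=> eqf x y z w L1 L2; pose v (i : 'I_4) := [:: x; y; z; w]`_i.
have := congr1 (meval v) eqf.
rewrite /qform_eval /bilin4 /= !(mevalD, mevalM, mevalZ, rmorphXn, mevalXU).
by rewrite /v /=.
Qed.

(** Evaluating the composition identity at points with coordinates 0 and 1
    isolates its coefficients. Those of x^2 zw, xy z^2, and so on, divided by
    [b], are the minors. Then [f3] and the form of the cube agree on the columns
    (p1, p2) and (q1, q2), whose determinant a_1 is nonzero, and this forces the
    outer coefficients to agree. *)
Lemma direct_composition_cube f1 f2 f3 : qb f1 = b -> qa f1 != 0 ->
  direct_composition G f1 f2 f3 -> cube_composition f1 f2 f3.
Proof.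
case: f1 f2 f3 => a1 b1 c1 [a2 b2 c2] [a3 b3 c3] /= -> {b1} a1_neq0.
case=> /= -> -> [p1 [q1 [r1 [s1 [p2 [q2 [r2 [s2 [eqf tR uR]]]]]]]]].
have := direct_composition_eval eqf => /=.
set N12 := fun x y z w : {poly F} => (a1 * x ^+ 2 + b * (x * y) + c1 * y ^+ 2) *
  (a2 * z ^+ 2 + b * (z * w) + c2 * w ^+ 2).
set N3 := fun x y z w : {poly F} =>
  let L1 := p1 * (x * z) + q1 * (x * w) + r1 * (y * z) + s1 * (y * w) in
  let L2 := p2 * (x * z) + q2 * (x * w) + r2 * (y * z) + s2 * (y * w) in
  a3 * L1 ^+ 2 + b * (L1 * L2) + c3 * L2 ^+ 2.
move=> N12E; have {N12E} N12E x y z w : N12 x y z w = N3 x y z w by apply: N12E.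
have a1E : a1 = p1 * q2 + p2 * q1.
  (* b a_1 is the coefficient of x^2 zw. *)
  apply: (mulfI b_neq0).
  transitivity (N12 1 0 1 0 + N12 1 0 0 1 + N12 1 0 1 1).
    by rewrite /N12; char2_ring two0.
  by rewrite !N12E /N3; char2_ring two0.
have c1E : c1 = r1 * s2 + r2 * s1.
  apply: (mulfI b_neq0).
  transitivity (N12 0 1 1 0 + N12 0 1 0 1 + N12 0 1 1 1).
    by rewrite /N12; char2_ring two0.
  by rewrite !N12E /N3; char2_ring two0.
have a2E : a2 = p1 * r2 + p2 * r1.
  apply: (mulfI b_neq0).
  transitivity (N12 1 0 1 0 + N12 0 1 1 0 + N12 1 1 1 0).
    by rewrite /N12; char2_ring two0.
  by rewrite !N12E /N3; char2_ring two0.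
have c2E : c2 = q1 * s2 + q2 * s1.
  apply: (mulfI b_neq0).
  transitivity (N12 1 0 0 1 + N12 0 1 0 1 + N12 1 1 0 1).
    by rewrite /N12; char2_ring two0.
  by rewrite !N12E /N3; char2_ring two0.
have bE : b = p1 * s2 + p2 * s1 + q1 * r2 + q2 * r1.
  (* b^2 is the coefficient of xyzw. *)
  apply: (mulfI b_neq0).
  transitivity (N12 1 0 1 0 + N12 1 0 0 1 + N12 1 0 1 1
    + N12 0 1 1 0 + N12 0 1 0 1 + N12 0 1 1 1
    + N12 1 1 1 0 + N12 1 1 0 1 + N12 1 1 1 1).
    by rewrite /N12; char2_ring two0.
  by rewrite !N12E /N3; char2_ring two0.
set A := p2 * s2 + q2 * r2; set C := p1 * s1 + q1 * r1.
have pE : (a3 + A) * p1 ^+ 2 = (c3 + C) * p2 ^+ 2.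
  apply: GRing.subr0_eq; transitivity (N3 1 0 1 0 + a1 * a2).
    by rewrite /N3 /A /C a1E a2E bE; char2_ring two0.
  by rewrite -N12E /N12; char2_ring two0.
have qE : (a3 + A) * q1 ^+ 2 = (c3 + C) * q2 ^+ 2.
  apply: GRing.subr0_eq; transitivity (N3 1 0 0 1 + a1 * c2).
    by rewrite /N3 /A /C a1E c2E bE; char2_ring two0.
  by rewrite -N12E /N12; char2_ring two0.
have a3E : a3 = A.
  apply: GRing.subr0_eq; apply: (mulIf (expf_neq0 2 a1_neq0)); rewrite mul0r.
  transitivity ((a3 + A) * p1 ^+ 2 * q2 ^+ 2 + (a3 + A) * q1 ^+ 2 * p2 ^+ 2).
    by rewrite a1E; char2_ring two0.
  by rewrite pE qE; char2_ring two0.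
have c3E : c3 = C.
  apply: GRing.subr0_eq; apply: (mulIf (expf_neq0 2 a1_neq0)); rewrite mul0r.
  transitivity ((c3 + C) * p2 ^+ 2 * q1 ^+ 2 + (c3 + C) * q2 ^+ 2 * p1 ^+ 2).
    by rewrite a1E; char2_ring two0.
  by rewrite -pE -qE; char2_ring two0.
exists p1, q1, r1, s1, p2, q2, r2, s2.
by split=> //; [rewrite a1E c1E | rewrite a2E c2E | rewrite a3E c3E].
Qed.

(** The witness is u = p2 s1 + q2 r1: applied to f_1 and f_3, the relation is
    the Pluecker relation of the cube sliced in another direction. *)
Lemma cube_composition_phi f1 f2 f3 : cube_composition f1 f2 f3 ->
  qb f3 = b /\ exists t, qa f3 * qc f3 = qa f1 * qc f1 + phi b t.
Proof.
case=> p1 [q1 [r1 [s1 [p2 [q2 [r2 [s2 [bE -> _ -> _]]]]]]]].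
split=> //=; exists (p2 * s1 + q2 * r1).
by rewrite /phi bE; char2_ring two0.
Qed.

(** The products a_1 a_2, a_1 c_2, c_1 a_2 and c_1 c_2 are the values of [f3] at
    the columns of the matrix. Hence multiplying Bezout relations for [f1] and
    [f2] gives one for [f3]. *)
Lemma cube_composition_primitive f1 f2 f3 : cube_composition f1 f2 f3 ->
  primitive f1 -> primitive f2 -> primitive f3.
Proof.
case=> p1 [q1 [r1 [s1 [p2 [q2 [r2 [s2 [bE -> -> -> _]]]]]]]].
case/primitiveP=> x [y [z /= xyz1]] /primitiveP[x' [y' [z' /= xyz1']]].
apply/primitiveP; rewrite /=.
exists (x * x' * p1 ^+ 2 + x * z' * q1 ^+ 2
  + z * x' * r1 ^+ 2 + z * z' * s1 ^+ 2).
exists (x * x' * p1 * p2 + x * z' * q1 * q2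
  + z * x' * r1 * r2 + z * z' * s1 * s2 + y + y' + y * y' * b).
exists (x * x' * p2 ^+ 2 + x * z' * q2 ^+ 2
  + z * x' * r2 ^+ 2 + z * z' * s2 ^+ 2).
have UE : x * (p1 * q2 + p2 * q1) + z * (r1 * s2 + r2 * s1) = 1 + y * b.
  by rewrite -xyz1; char2_ring two0.
have VE : x' * (p1 * r2 + p2 * r1) + z' * (q1 * s2 + q2 * s1) = 1 + y' * b.
  by rewrite -xyz1'; char2_ring two0.
transitivity ((x * (p1 * q2 + p2 * q1) + z * (r1 * s2 + r2 * s1))
  * (x' * (p1 * r2 + p2 * r1) + z' * (q1 * s2 + q2 * s1))
  + y * b + y' * b + y * b * (y' * b)).
  by rewrite bE; char2_ring two0.
by rewrite UE VE; char2_ring two0.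
Qed.

(** Exchanging the columns q and r fixes P_23 and replaces u by u + P_23. *)
Lemma cube_composition_sym f1 f2 f3 :
  cube_composition f1 f2 f3 -> cube_composition f2 f1 f3.
Proof.
case=> p1 [q1 [r1 [s1 [p2 [q2 [r2 [s2 [bE -> -> -> [tR uR]]]]]]]]].
exists p1, r1, q1, s1, p2, r2, q2, s2; split=> //.
- by rewrite bE; ring.
- by congr QForm; ring.
split; first by rewrite (_ : _ + _ = q1 * r2 + q2 * r1) //; ring.
have -> : p2 * s1 + r2 * q1 = q1 * r2 + q2 * r1 + (p2 * s1 + q2 * r1).
  by char2_ring two0.
exact: RsetD.
Qed.

(** The matrix of the equivalence combines the columns p, r and the columns
    q, s; this adds the element of R_b that measures the equivalence to both
    P_23 and u. *)
Lemma cube_composition_pequiv f1 f1' f2 f3 : cube_composition f1 f2 f3 ->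
  properly_equivalent G f1 f1' -> cube_composition f1' f2 f3.
Proof.
case=> p1 [q1 [r1 [s1 [p2 [q2 [r2 [s2 [bE -> -> -> [tR uR]]]]]]]]].
case/properly_equivalentP=> _ _ [p [q [r [s [det1 -> vR]]]]].
exists (p * p1 + q * r1), (p * q1 + q * s1).
exists (r * p1 + s * r1), (r * q1 + s * s1).
exists (p * p2 + q * r2), (p * q2 + q * s2).
exists (r * p2 + s * r2), (r * q2 + s * s2).
have tvR := RsetD b_neq0 subG tR vR; have uvR := RsetD b_neq0 subG uR vR.
split.
- by rewrite [LHS]bE; char2_ring two0 with det1.
- by congr QForm; rewrite bE; char2_ring two0.
- by congr QForm; char2_ring two0 with det1.
- by congr QForm; char2_ring two0 with det1.
split.
  rewrite (_ : _ + _ = q1 * r2 + q2 * r1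
    + ((p1 * q2 + p2 * q1) * p * r + b * q * r
    + (r1 * s2 + r2 * s1) * q * s)) //.
  by rewrite bE; char2_ring two0 with det1.
rewrite (_ : _ + _ = p2 * s1 + q2 * r1
    + ((p1 * q2 + p2 * q1) * p * r + b * q * r
    + (r1 * s2 + r2 * s1) * q * s)) //.
by rewrite bE; char2_ring two0 with det1.
Qed.

End Cubes.

(** * Uniqueness and existence of the composite *)

Section Composite.

Variables (F : finFieldType) (G : {set F}) (b : {poly F}).
Hypotheses (two0 : 2 = 0 :> {poly F}) (b_neq0 : b != 0).
Hypotheses (subG : zmod_closed (mem G)) (G1 : 1 \notin G).
Hypothesis cardG : (#|G| * 2)%N = #|F|.

(** Both matrices have the same minors (P_23 by the choice of a root in R_b), so
    g M = M' for some g in SL_2. The form [f3'] then arises from [f3] by g with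
    its rows and columns reversed, and u' is the sum of u and the element that
    measures this equivalence. *)
Lemma cube_composition_unique f1 f2 f3 f3' :
  primitive f1 -> primitive f3 -> primitive f3' ->
  cube_composition G b f1 f2 f3 -> cube_composition G b f1 f2 f3' ->
  properly_equivalent G f3 f3'.
Proof.
move=> prim1 prim3 prim3'.
case=> p1 [q1 [r1 [s1 [p2 [q2 [r2 [s2 [bE f1E f2E f3E [tR uR]]]]]]]]].
case=> p1' [q1' [r1' [s1' [p2' [q2' [r2' [s2'
  [bE' f1E' f2E' f3E' [tR' uR']]]]]]]]].
move: f1E'; rewrite f1E => -[P12 P34]; move: f2E'; rewrite f2E => -[P13 P24].
have P23 : q1 * r2 + q2 * r1 = q1' * r2' + q2' * r1'.
  apply: (Rset_phi_inj two0 b_neq0 subG G1 tR tR').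
  transitivity ((p1 * q2 + p2 * q1) * (r1 * s2 + r2 * s1)
    + (p1 * r2 + p2 * r1) * (q1 * s2 + q2 * s1)).
    by rewrite /phi bE; char2_ring two0.
  by rewrite P12 P34 P13 P24 /phi bE'; char2_ring two0.
have P14 : p1 * s2 + p2 * s1 = p1' * s2' + p2' * s1'.
  transitivity (b + (q1 * r2 + q2 * r1)); first by rewrite bE; char2_ring two0.
  by rewrite P23 bE'; char2_ring two0.
move: prim1; rewrite f1E => /primitiveP[x [y [z /= xyz1]]].
pose m (k : bool) (i : 'I_4) :=
  if k then [:: p2; q2; r2; s2]`_i else [:: p1; q1; r1; s1]`_i.
pose n (k : bool) (i : 'I_4) :=
  if k then [:: p2'; q2'; r2'; s2']`_i else [:: p1'; q1'; r1'; s1']`_i.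
(* The relation xyz1 for f1, with b written as P_14 + P_23. *)
pose l (i j : 'I_4) := match val i, val j with
  | 0, 1 => x | 0, 3 | 1, 2 => y | 2, 3 => z | _, _ => 0 end.
have [||g [gE detg]] := @eq_minors_SL2 _ _ m n l.
- have opp2 (u v : {poly F}) : u - v = u + v by char2_ring two0.
  have diag (u v u' v' : {poly F}) : u * v + v * u = u' * v' + v' * u'.
    by char2_ring two0.
  have sym (u v w t u' v' w' t' : {poly F}) :
      u * t + w * v = u' * t' + w' * v' -> v * w + t * u = v' * w' + t' * u'.
    by rewrite addrC mulrC [t * u]mulrC => ->; ring.
  move=> i j; rewrite !opp2.
  case: i => [[|[|[|[|//]]]] ?]; case: j => [[|[|[|[|//]]]] ?];
    rewrite /m /n /=; first [exact: diag
    | exact: P12 | exact: P13 | exact: P14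
    | exact: P23 | exact: P24 | exact: P34
    | exact: (sym _ _ _ _ _ _ _ _ P12) | exact: (sym _ _ _ _ _ _ _ _ P13)
    | exact: (sym _ _ _ _ _ _ _ _ P14) | exact: (sym _ _ _ _ _ _ _ _ P23)
    | exact: (sym _ _ _ _ _ _ _ _ P24) | exact: (sym _ _ _ _ _ _ _ _ P34)].
- rewrite !big_ord_recl !big_ord0 /m /l /= -xyz1 [in RHS]bE; char2_ring two0.
pose p := g false false; pose q := g false true.
pose r := g true false; pose s := g true true.
have det1 : s * p = 1 + r * q by rewrite -detg /p /q /r /s; ring.
have [p1E q1E r1E s1E] : [/\ p1' = p * p1 + q * p2, q1' = p * q1 + q * q2,
    r1' = p * r1 + q * r2 & s1' = p * s1 + q * s2].
  by split; [have := gE false 0 | have := gE false 1 | have := gE false 2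
    | have := gE false 3].
have [p2E q2E r2E s2E] : [/\ p2' = r * p1 + s * p2, q2' = r * q1 + s * q2,
    r2' = r * r1 + s * r2 & s2' = r * s1 + s * s2].
  by split; [have := gE true 0 | have := gE true 1 | have := gE true 2
    | have := gE true 3].
rewrite f3E in prim3 *; apply/properly_equivalentP; split=> //.
exists s, r, q, p; split=> //.
  by rewrite f3E'; congr QForm;
    rewrite ?p1E ?q1E ?r1E ?s1E ?p2E ?q2E ?r2E ?s2E bE; char2_ring two0.
suff -> : (p2 * s2 + q2 * r2) * s * q + b * r * q + (p1 * s1 + q1 * r1) * r * p
    = p2 * s1 + q2 * r1 + (p2' * s1' + q2' * r1') by apply: RsetD.
by rewrite r1E s1E p2E q2E bE; char2_ring two0 with det1.
Qed.

(** Let e be the gcd of a_1, a_2 and t + b. A matrix with first entry e and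
    second row (0, a_1, a_2, t + b) / e has the minors P_12 = a_1, P_13 = a_2
    and P_14 = t + b. A Bezout relation for e supplies the rest of the first row
    such that P_23 = t, and the Pluecker relation for the remaining two minors
    is the hypothesis on t. *)
Lemma cube_composition_exists a1 c1 a2 c2 t : a1 != 0 -> Rset G b t ->
  a1 * c1 + a2 * c2 = phi b t ->
  exists f3, cube_composition G b (QForm a1 b c1) (QForm a2 b c2) f3.
Proof.
move=> a1_neq0 tR.
have [e [x [y [z [eE /dvdpP[A a1E] /dvdpP[B a2E] /dvdpP[D tbE]]]]]] :=
  bezout3 a1 a2 (t + b).
have e_neq0 : e != 0 by apply: contraNneq a1_neq0 => e0; rewrite a1E e0 mulr0.
have ABD : x * A + y * B + z * D = 1.
  by apply: (mulIf e_neq0); rewrite mul1r [RHS]eE a1E a2E tbE; ring.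
have bE : b = t + D * e by rewrite -tbE; char2_ring two0.
rewrite /phi => tE.
have cE : c1 * A + c2 * B = t * D.
  apply: (mulIf e_neq0); transitivity (a1 * c1 + a2 * c2).
    by rewrite a1E a2E; ring.
  by rewrite tE bE; char2_ring two0.
pose q1 := y * t + z * c2; pose r1 := x * t + z * c1.
pose s1 := x * c2 + y * c1.
have P23 : q1 * B + A * r1 = t.
  transitivity (t * (x * A + y * B) + z * (c1 * A + c2 * B)).
    by rewrite /q1 /r1; ring.
  by rewrite cE -[RHS]mulr1 -ABD; ring.
have P24 : q1 * D + A * s1 = c2.
  transitivity (y * (t * D) + c2 * (x * A + z * D) + y * (c1 * A)).
    by rewrite /q1 /s1; ring.
  by rewrite -cE -[RHS]mulr1 -ABD; char2_ring two0.
have P34 : r1 * D + B * s1 = c1.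
  transitivity (x * (t * D) + c1 * (y * B + z * D) + x * (c2 * B)).
    by rewrite /r1 /s1; ring.
  by rewrite -cE -[RHS]mulr1 -ABD; char2_ring two0.
(* If u = A r1 lies outside R_b, then exchange the rows. *)
have [uR | uR] := Rset_or b_neq0 subG G1 cardG (A * r1).
  exists (QForm (0 * D + A * B) b (e * s1 + q1 * r1)).
  exists e, q1, r1, s1, 0, A, B, D.
  split=> //.
  - by rewrite bE -[in LHS]P23; ring.
  - by congr QForm; rewrite -?P34 ?a1E; ring.
  - by congr QForm; rewrite -?P24 ?a2E; ring.
  by rewrite P23 mul0r add0r.
exists (QForm (e * s1 + q1 * r1) b (0 * D + A * B)), 0, A, B, D, e, q1, r1, s1.
split=> //.
- by rewrite bE -[in LHS]P23; ring.
- by congr QForm; rewrite -?P34 ?a1E; ring.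
- by congr QForm; rewrite -?P24 ?a2E; ring.
split; first by rewrite addrC P23.
suff -> : e * D + q1 * B = A * r1 + b by [].
by rewrite bE -[in RHS]P23; char2_ring two0.
Qed.

(** Dirichlet composition of concordant forms: L_1 = xz + c yw and
    L_2 = xw + a yz + b yw. *)
Lemma cube_composition_identity a c :
  cube_composition G b (QForm 1 b (a * c)) (QForm a b c) (QForm a b c).
Proof.
exists 1, 0, 0, c, 0, 1, a, b.
split; [by ring | by congr QForm; ring | by congr QForm; ring
  | by congr QForm; ring |].
by split; rewrite ?mul0r ?mulr0 addr0; apply: Rset0.
Qed.

(** L_1 = b xz + a xw + c yz and L_2 = xz + yw; the latter makes the outer
    coefficient p_2 s_2 + q_2 r_2 equal to 1. *)
Lemma cube_composition_inverse a c :
  cube_composition G b (QForm a b c) (QForm c b a) (QForm 1 b (a * c)).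
Proof.
exists b, a, c, 0, 1, 0, 0, 1.
split; [by ring | by congr QForm; ring | by congr QForm; ring
  | by congr QForm; ring |].
by split; rewrite ?mul0r ?mulr0 addr0; apply: Rset0.
Qed.

End Composite.

(** * The composition of classes *)

Section ClassGroup.

Variables (F : finFieldType) (G : {set F}) (b Delta : {poly F}).
Hypotheses (two0 : 2 = 0 :> {poly F}) (b_neq0 : b != 0).
Hypotheses (subG : zmod_closed (mem G)) (G1 : 1 \notin G).
Hypothesis cardG : (#|G| * 2)%N = #|F|.
Hypothesis nphiDelta : ~ exists t : {poly F}, phi b t = Delta.

(** The forms whose classes make up C(b, Delta). *)
Definition Delta_form (f : qform F) : Prop :=
  [/\ primitive f, qb f = b & exists t, qa f * qc f = Delta + phi b t].

Lemma phiD u v : phi b (u + v) = phi b u + phi b v.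
Proof. by rewrite /phi; char2_ring two0. Qed.

(** If a = 0 then phi(t) = Delta. *)
Lemma Delta_form_qa_neq0 f : Delta_form f -> qa f != 0.
Proof.
case=> _ _ [t ft]; apply/eqP => a0; apply: nphiDelta; exists t.
rewrite a0 mul0r in ft; rewrite -[LHS]addr0 ft; char2_ring two0.
Qed.

Lemma Delta_form_pequiv f f' :
  properly_equivalent G f f' -> Delta_form f -> Delta_form f'.
Proof.
move=> ff' [prim fb [t ft]]; have [f'b [u f'u]] := pequiv_phi two0 ff'.
have [_ prim' _] := ff'.
split=> //; first by rewrite f'b.
by exists (t + u); rewrite f'u ft fb phiD -addrA.
Qed.

Lemma qclass_refl f : Delta_form f -> qclass G f f.
Proof. by case=> prim fb _; apply: pequiv_refl; rewrite ?fb. Qed.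

Lemma qclass_eq f f' : qb f = b -> properly_equivalent G f f' ->
  qclass G f = qclass G f'.
Proof.
move=> fb ff'; have [f'b _] := pequiv_phi two0 ff'.
apply/seteqP; split=> g; rewrite /qclass /=;
  apply: pequiv_trans; rewrite ?f'b ?fb //.
exact: pequiv_sym.
Qed.

Lemma classesP X :
  classes G b Delta X <-> exists2 f, Delta_form f & X = qclass G f.
Proof.
split=> [[a [c [prim [t act] ->]]] | [[a b' c] [/= prim b'E [t act]] ->]].
  exists (QForm a b c) => //; split=> //.
  by exists t => /=; rewrite -act addrC subrK.
rewrite b'E in prim *; exists a, c; split=> //.
by exists t; rewrite act addrAC subrr add0r.
Qed.

Lemma classes_mem X f : classes G b Delta X -> X f ->
  Delta_form f /\ X = qclass G f.
Proof.
case/classesP=> g g_form -> gf; split; first exact: Delta_form_pequiv g_form.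
by apply: qclass_eq => //; case: g_form.
Qed.

Lemma classes_qclass f : Delta_form f -> classes G b Delta (qclass G f).
Proof. by move=> f_form; apply/classesP; exists f. Qed.

Lemma Delta_form_cube_composition f1 f2 f3 : Delta_form f1 -> Delta_form f2 ->
  cube_composition G b f1 f2 f3 -> Delta_form f3.
Proof.
case=> prim1 _ [t f1t] [prim2 _ _] f123.
have [f3b [u f3u]] := cube_composition_phi two0 f123.
split=> //; first exact: (cube_composition_primitive two0 f123).
by exists (t + u); rewrite f3u f1t phiD -addrA.
Qed.

(** P_23 has to be a root of phi(t) = a_1 c_1 + a_2 c_2; the sum of the elements
    t_1 and t_2 attached to the two forms is one. *)
Lemma Delta_form_composable f1 f2 : Delta_form f1 -> Delta_form f2 ->
  exists f3, cube_composition G b f1 f2 f3.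
Proof.
move=> f1_form f2_form; have := Delta_form_qa_neq0 f1_form.
case: f1 f1_form => a1 b1 c1 [_ /= -> [t1 f1t]] a1_neq0.
case: f2 f2_form => a2 b2 c2 [_ /= -> [t2 f2t]].
have eq_t : a1 * c1 + a2 * c2 = phi b (t1 + t2).
  by rewrite f1t f2t phiD; char2_ring two0.
have [tR | tR] := Rset_or b_neq0 subG G1 cardG (t1 + t2);
  apply: (cube_composition_exists two0 b_neq0 subG G1 cardG a1_neq0 tR) => //.
by rewrite eq_t /phi; char2_ring two0.
Qed.

(** The union of the classes of all composites of all representatives; that it
    is a single class is the content of [class_compE]. *)
Definition class_comp (X Y : set (qform F)) : set (qform F) :=
  [set f | exists f1 f2 f3, [/\ X f1, Y f2, direct_composition G f1 f2 f3
                              & properly_equivalent G f3 f]].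

(** A composite of any representatives g_1, g_2 is also a composite of f_1 and
    f_2, hence properly equivalent to f_3. *)
Lemma class_compE f1 f2 f3 : Delta_form f1 -> Delta_form f2 ->
  cube_composition G b f1 f2 f3 ->
  class_comp (qclass G f1) (qclass G f2) = qclass G f3.
Proof.
move=> f1_form f2_form f123.
have f3_form := Delta_form_cube_composition f1_form f2_form f123.
apply/seteqP; split=> f; last first.
  move=> f3f; exists f1, f2, f3; split=> //; try exact: qclass_refl.
  exact: (cube_direct_composition two0 f123).
case=> g1 [g2 [g3 [f1g1 f2g2 g123 g3f]]].
have g1_form := Delta_form_pequiv f1g1 f1_form.
have g1b : qb g1 = b by case: g1_form.
have {}g123 := direct_composition_cube two0 b_neq0 g1b
  (Delta_form_qa_neq0 g1_form) g123.
have f1g23 : cube_composition G b f1 g2 g3.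
  exact: (cube_composition_pequiv two0 b_neq0 subG g123 (pequiv_sym two0 f1g1)).
have f12g3 : cube_composition G b f1 f2 g3.
  apply: (cube_composition_sym two0 b_neq0 subG).
  apply: (cube_composition_pequiv two0 b_neq0 subG _ (pequiv_sym two0 f2g2)).
  exact: (cube_composition_sym two0 b_neq0 subG f1g23).
have g3_form := Delta_form_cube_composition f1_form f2_form f12g3.
have [prim1 _ _] := f1_form; have [prim3 f3b _] := f3_form.
have [prim_g3 _ _] := g3_form.
have f3g3 := cube_composition_unique two0 b_neq0 subG G1
  prim1 prim3 prim_g3 f123 f12g3.
by apply: pequiv_trans g3f; rewrite ?f3b.
Qed.

(** For t in R_b with a c = Delta + phi(t), the form (1, b, a c) takes the value
    Delta at (t, 1), and the orientation condition for the matrix with rows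
    (1, 0) and (t, 1) says that t lies in R_b. *)
Lemma qclass_one a c : Delta_form (QForm a b c) ->
  Delta_form (QForm 1 b (a * c)) /\
  qclass G (QForm 1 b (a * c)) = qclass G (QForm 1 b Delta).
Proof.
case=> _ _ /= [t' act'].
have [t tR act] : exists2 t, Rset G b t & a * c = Delta + phi b t.
  have [tR | tR] := Rset_or b_neq0 subG G1 cardG t'; first by exists t'.
  by exists (t' + b); rewrite // act' /phi; char2_ring two0.
have prim1 d : primitive (QForm 1 b d).
  by apply/primitiveP; exists 1, 0, 0; rewrite /= mul1r !mul0r !addr0.
split; first by split=> //=; exists t; rewrite mul1r.
apply: qclass_eq => //; apply/properly_equivalentP; split=> //.
exists 1, 0, t, 1; split; first by ring.
  by congr QForm; rewrite ?act /phi; char2_ring two0.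
by rewrite mul1r mul1r !(mulr0, mul0r) !addr0.
Qed.

Lemma Delta_form_swap a c :
  Delta_form (QForm a b c) -> Delta_form (QForm c b a).
Proof.
case=> prim _ [t act]; split=> //; last by exists t; rewrite mulrC.
by move=> d; rewrite /= => dc db da; apply: prim.
Qed.

End ClassGroup.

Theorem theorem2p17 (F : finFieldType) (n : nat) (G : {set F})
    (b Delta : {poly F})
    (cardF : #|F| = (2 ^ n)%N)
    (subG : zmod_closed (mem G)) (cardG : #|G| = (2 ^ n.-1)%N)
    (G1 : 1 \notin G)
    (b_neq0 : b <> 0)
    (nphiDelta : ~ (exists t : {poly F}, phi b t = Delta)) :
  exists op : set (qform F) -> set (qform F) -> set (qform F),
    [/\ (* independently of the representatives f1 and f2, op X Y is the
           exactly one class containing a direct composition of f1 and f2 *)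
        forall X Y : set (qform F),
          classes G b Delta X -> classes G b Delta Y ->
          forall f1 f2 : qform F, X f1 -> Y f2 ->
            unique (fun Z : set (qform F) =>
                      classes G b Delta Z /\
                      exists f3 : qform F,
                        Z f3 /\ direct_composition G f1 f2 f3)
                   (op X Y),
        forall X Y : set (qform F),
          classes G b Delta X -> classes G b Delta Y -> op X Y = op Y X,
        forall X : set (qform F),
          classes G b Delta X -> op (qclass G (QForm 1 b Delta)) X = X &
        forall a c : {poly F},
          classes G b Delta (qclass G (QForm a b c)) ->
          op (qclass G (QForm a b c)) (qclass G (QForm c b a))
            = qclass G (QForm 1 b (a * c)) /\
          qclass G (QForm 1 b (a * c)) = qclass G (QForm 1 b Delta)].
Proof.
have two0 : 2 = 0 :> {poly F}.
  have /pcharf0 F2 := card_finPcharP cardF (isT : prime 2).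
  by rewrite -polyC_natr F2 polyC0.
have {}b_neq0 : b != 0 by apply/eqP.
have {cardF} cardG2 : (#|G| * 2)%N = #|F|.
  rewrite cardG cardF; case: n cardF {cardG} => [|n] cardF.
    by have := finNzRing_gt1 F; rewrite cardF.
  by rewrite expnSr.
exists (class_comp G); split.
- move=> X Y clX clY f1 f2 Xf1 Yf2.
  have [f1_form ->] := classes_mem two0 b_neq0 subG clX Xf1.
  have [f2_form ->] := classes_mem two0 b_neq0 subG clY Yf2.
  have [f3 f123] := Delta_form_composable two0 b_neq0 subG G1 cardG2 nphiDelta
    f1_form f2_form.
  have f3_form := Delta_form_cube_composition two0 f1_form f2_form f123.
  rewrite (class_compE two0 b_neq0 subG G1 nphiDelta f1_form f2_form f123).
  split.
    split; first exact: classes_qclass.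
    exists f3; split; first exact: (qclass_refl b_neq0 subG f3_form).
    exact: (cube_direct_composition two0 f123).
  move=> Z [clZ [g3 [Zg3 g123]]].
  have [g3_form ->] := classes_mem two0 b_neq0 subG clZ Zg3.
  have f1b : qb f1 = b by case: f1_form.
  have {}g123 := direct_composition_cube two0 b_neq0 f1b
    (Delta_form_qa_neq0 two0 nphiDelta f1_form) g123.
  by rewrite -(class_compE two0 b_neq0 subG G1 nphiDelta f1_form f2_form f123)
    (class_compE two0 b_neq0 subG G1 nphiDelta f1_form f2_form g123).
- move=> X Y /classesP[f1 f1_form ->] /classesP[f2 f2_form ->].
  have [f3 f123] := Delta_form_composable two0 b_neq0 subG G1 cardG2 nphiDelta
    f1_form f2_form.
  rewrite (class_compE two0 b_neq0 subG G1 nphiDelta f1_form f2_form f123).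
  by rewrite (class_compE two0 b_neq0 subG G1 nphiDelta f2_form f1_form
    (cube_composition_sym two0 b_neq0 subG f123)).
- move=> X /classesP[[a b' c] f_form ->].
  have b'E : b' = b by case: f_form.
  rewrite {}b'E in f_form *.
  have [one_form <-] := qclass_one two0 b_neq0 subG G1 cardG2 f_form.
  apply: (class_compE two0 b_neq0 subG G1 nphiDelta) => //.
  exact: cube_composition_identity b_neq0 subG _ _.
move=> a c /classesP[f f_form eq_cl].
have f_equiv : qclass G (QForm a b c) f.
  by rewrite eq_cl; apply: (qclass_refl b_neq0 subG f_form).
have abc_form := Delta_form_pequiv two0 (pequiv_sym two0 f_equiv) f_form.
have [one_form one_eq] := qclass_one two0 b_neq0 subG G1 cardG2 abc_form.
split=> //.
apply: (class_compE two0 b_neq0 subG G1 nphiDelta) => //.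
  exact: Delta_form_swap abc_form.
exact: cube_composition_inverse b_neq0 subG _ _.
Qed.
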